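(* (Basic equations for Krein–Adler polynomials.) Consider one of the Hermite (H), Laguerre (L) or Jacobi (J) cases. Let $\mathcal D=\{d_1<\dots<d_M\}$ be a set of positive integers satisfying the Krein–Adler condition $\prod_{j=1}^M(m-d_j)\ge0$ for all integers $m\ge0$, and let $\mathcal N\ge1$ be an integer with $\mathcal N\notin\mathcal D$. Let $\mathcal D'$ be obtained from $\mathcal D=(d_1,\dots,d_M)$ by replacing one entry $d_j$ (in the same position) by an integer $\epsilon$ with $0\le\epsilon<d_j$, $\epsilon\notin\mathcal D$, $\epsilon\ne\mathcal N$, and put $$\widetilde{\mathcal E}=\mathcal E(d_j)+\mathcal E(\epsilon)-\mathcal E(\mathcal N).$$ Then the following identities of polynomials in $\eta$ hold: $$\Xi_{\mathcal D}(\eta)\bigl(\widetilde{\mathcal H}_{\mathcal D}P_{\mathcal D',\mathcal N}(\eta)-\widetilde{\mathcal E}\,P_{\mathcal D',\mathcal N}(\eta)\bigr)=2\bigl(\mathcal E(\mathcal N)-\mathcal E(\epsilon)\bigr)P_{\mathcal D,\mathcal N}(\eta)\,\Xi_{\mathcal D'}(\eta),$$ $$\Xi_{\mathcal D'}(\eta)\bigl(\widetilde{\mathcal H}_{\mathcal D'}P_{\mathcal D,\mathcal N}(\eta)-\widetilde{\mathcal E}\,P_{\mathcal D,\mathcal N}(\eta)\bigr)=2\bigl(\mathcal E(\mathcal N)-\mathcal E(d_j)\bigr)P_{\mathcal D',\mathcal N}(\eta)\,\Xi_{\mathcal D}(\eta).$$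
   Context: Base polynomials and energies: $P_n=H_n$, $\mathcal E(n)=2n$ (Hermite, H); $P_n=L_n^{(g-1/2)}$, $\mathcal E(n)=4n$ (Laguerre, L, real $g>\frac12$); $P_n=P_n^{(g-1/2,h-1/2)}$, $\mathcal E(n)=4n(n+g+h)$ (Jacobi, J, real $g,h>\frac12$). ${\rm W}[f_1,\dots,f_r](\eta)=\det(d^{i-1}f_j/d\eta^{i-1})_{1\le i,j\le r}$. For a list $\mathcal A=(a_1,\dots,a_M)$ of distinct non-negative integers, $$P_{\mathcal A,n}(\eta)={\rm W}[P_{a_1},\dots,P_{a_M},P_n](\eta),\qquad \Xi_{\mathcal A}(\eta)={\rm W}[P_{a_1},\dots,P_{a_M}](\eta),$$ and $$\widetilde{\mathcal H}_{\mathcal A}=-4\Bigl(c_2\frac{d^2}{d\eta^2}+\Bigl(C_1-2c_2\frac{\Xi_{\mathcal A}'}{\Xi_{\mathcal A}}\Bigr)\frac d{d\eta}+c_2\frac{\Xi_{\mathcal A}''}{\Xi_{\mathcal A}}-C_1^-\frac{\Xi_{\mathcal A}'}{\Xi_{\mathcal A}}-\tfrac14\mathcal E(M)\Bigr),$$ where - H: $c_2=\frac14$, $C_1=C_1^-=-\frac\eta2$; - L: $c_2=\eta$, $C_1=g+M+\frac12-\eta$, $C_1^-=g+M-\frac12-\eta$; - J: $c_2=1-\eta^2$, $C_1=h-g-(g+h+2M+1)\eta$, $C_1^-=h-g-(g+h+2M-1)\eta$. (Equivalently, $\widetilde{\mathcal H}_{\mathcal A}=\psi_{\mathcal A}^{-1}\circ\mathcal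 H_{\mathcal A}\circ\psi_{\mathcal A}$ is the similarity transform, by $\psi_{\mathcal A}(x)=\phi_0(x)\,(d\eta/dx)^M/\Xi_{\mathcal A}(\eta(x))$, of the Schrödinger operator $\mathcal H_{\mathcal A}=-\partial_x^2+U-2\partial_x^2\log|{\rm W}[\phi_{a_1},\dots,\phi_{a_M}](x)|$, where $\phi_n=\phi_0P_n(\eta(x))$ are the eigenfunctions of $-\partial_x^2+U$: $\eta=x$, $\phi_0=e^{-x^2/2}$, $U=x^2-1$ (H); $\eta=x^2$, $\phi_0=e^{-x^2/2}x^g$, $U=x^2+g(g-1)/x^2-2g-1$ (L); $\eta=\cos2x$, $\phi_0=(\sin x)^g(\cos x)^h$, $U=g(g-1)/\sin^2x+h(h-1)/\cos^2x-(g+h)^2$ (J).) *)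

(* Defs.v *)
From HB Require Import structures.
From mathcomp Require Import all_boot all_order all_algebra.

Set Implicit Arguments.
Unset Strict Implicit.
Unset Printing Implicit Defensive.

Import Order.TTheory GRing.Theory Num.Theory.

Local Open Scope ring_scope.

(* The embedding of polynomials into rational functions. *)
Notation "p %:F" := (FracField.tofrac p) : ring_scope.

(* The shifted (rising) factorial (a)_k = a (a + 1) ... (a + k - 1). *)
Definition pochhammer (R : realFieldType) (a : R) (k : nat) : R :=
  \prod_(i < k) (a + i%:R).

(* H_n(x) = n! sum_{l <= n/2} (-1)^l (2x)^(n-2l) / (l! (n-2l)!),
   the physicists' normalization. *)
Definition hermite (R : realFieldType) (n : nat) : {poly R} :=
  \sum_(l < n./2.+1)
    ((-1) ^+ l * n`!%:R / (l`!%:R * (n - l.*2)`!%:R)) *: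
      (2%:R *: 'X) ^+ (n - l.*2).

(* L_n^(a)(x) = sum_{k <= n} (a+k+1)_(n-k) / ((n-k)! k!) (-x)^k. *)
Definition laguerre (R : realFieldType) (a : R) (n : nat) : {poly R} :=
  \sum_(k < n.+1)
    (pochhammer (a + k%:R + 1) (n - k) / ((n - k)`!%:R * k`!%:R)) *:
      (- 'X) ^+ k.

(* P_n^(a,b)(x) = (a+1)_n / n! 2F1(-n, n+a+b+1; a+1; (1-x)/2)
     = sum_{k <= n} (n+a+b+1)_k (a+k+1)_(n-k) / (k! (n-k)!) ((x-1)/2)^k. *)
Definition jacobi (R : realFieldType) (a b : R) (n : nat) : {poly R} :=
  \sum_(k < n.+1)
    (pochhammer (n%:R + a + b + 1) k * pochhammer (a + k%:R + 1) (n - k)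
       / (k`!%:R * (n - k)`!%:R)) *:
      (2%:R^-1 *: ('X - 1)) ^+ k.

Inductive baseFamily (R : Type) : Type :=
  | Hermite
  | Laguerre of R
  | Jacobi of R & R.

Arguments Hermite {R}.

Definition admissible (R : realFieldType) (F : baseFamily R) : Prop :=
  match F with
  | Hermite => True
  | Laguerre g => 2%:R^-1 < g
  | Jacobi g h => 2%:R^-1 < g /\ 2%:R^-1 < h
  end.

Definition basePoly (R : realFieldType) (F : baseFamily R) (n : nat) : {poly R} :=
  match F with
  | Hermite => hermite R n
  | Laguerre g => laguerre (g - 2%:R^-1) n
  | Jacobi g h => jacobi (g - 2%:R^-1) (h - 2%:R^-1) n
  end.

Definition energy (R : realFieldType) (F : baseFamily R) (n : nat) : R :=
  match F with
  | Hermite => 2%:R * n%:R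
  | Laguerre _ => 4%:R * n%:R
  | Jacobi g h => 4%:R * n%:R * (n%:R + g + h)
  end.

Definition wronskian (R : realFieldType) (s : seq {poly R}) : {poly R} :=
  \det (\matrix_(i < size s, j < size s) (s`_j)^`(i)).

Definition Xi (R : realFieldType) (F : baseFamily R) (A : seq nat) : {poly R} :=
  wronskian [seq basePoly F a | a <- A].

Definition multiPoly (R : realFieldType) (F : baseFamily R) (A : seq nat)
    (n : nat) : {poly R} :=
  wronskian (rcons [seq basePoly F a | a <- A] (basePoly F n)).

Definition c2 (R : realFieldType) (F : baseFamily R) : {poly R} :=
  match F with
  | Hermite => (4%:R^-1)%:P
  | Laguerre _ => 'X
  | Jacobi _ _ => 1 - 'X ^+ 2
  end.

Definition C1 (R : realFieldType) (F : baseFamily R) (M : nat) : {poly R} :=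
  match F with
  | Hermite => - (2%:R^-1 *: 'X)
  | Laguerre g => (g + M%:R + 2%:R^-1)%:P - 'X
  | Jacobi g h => (h - g)%:P - (g + h + 2%:R * M%:R + 1) *: 'X
  end.

Definition C1minus (R : realFieldType) (F : baseFamily R) (M : nat) : {poly R} :=
  match F with
  | Hermite => - (2%:R^-1 *: 'X)
  | Laguerre g => (g + M%:R - 2%:R^-1)%:P - 'X
  | Jacobi g h => (h - g)%:P - (g + h + 2%:R * M%:R - 1) *: 'X
  end.

(* A second order differential operator whose coefficients are rational
   functions of eta: it sends a polynomial to a rational function. *)
Definition Htilde (R : realFieldType) (F : baseFamily R) (A : seq nat)
    (p : {poly R}) : {fraction {poly R}} :=
  let M := size A in
  let X := (Xi F A)%:F in
  let X' := ((Xi F A)^`())%:F in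
  let X'' := ((Xi F A)^`(2))%:F in
  - 4%:R * ((c2 F)%:F * (p^`(2))%:F
            + ((C1 F M)%:F - 2%:R * (c2 F)%:F * (X' / X)) * (p^`())%:F
            + ((c2 F)%:F * (X'' / X) - (C1minus F M)%:F * (X' / X)
               - ((energy F M / 4%:R)%:P)%:F) * p%:F).

Definition KreinAdler (D : seq nat) : Prop :=
  forall m : nat, 0 <= \prod_(d <- D) (m%:Z - d%:Z).

(* Main.v *)
Require Import Defs.
From HB Require Import structures.
From mathcomp Require Import all_boot all_order all_algebra.
From mathcomp Require Import perm polyorder.
From mathcomp Require Import ring lra zify.

Set Implicit Arguments.
Unset Strict Implicit.
Unset Printing Implicit Defensive.

Import Order.TTheory GRing.Theory Num.Theory.

Local Open Scope ring_scope.

(* Remove d_j from D to get B, and put b = W[B], u = W[B, P_dj], v = W[B, P_eps],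
   w = W[B, P_N], p = W[B, P_dj, P_N], q = W[B, P_eps, P_N].  Jacobi's identity gives
   b p = u w' - u' w and b q = v w' - v' w.  By Crum's theorem u, v, w satisfy the
   M-1 fold Darboux transformed equation, whose potential depends on b only; it cancels
   from the derivative of v w' - v' w, leaving a first order relation between b and q
   with source v w.  Differentiating that relation, multiplying by u and using
   u w' = b p + u' w and b q = v w' - v' w gives the M-fold equation for q with source
   proportional to v p, which is the claimed identity.  The case v = u of the same
   computation is the induction step of Crum's theorem.  The order of the columns only
   introduces a sign that occurs twice on each side. *)

(** * Derivatives of determinants and Jacobi's determinant identity *)

Lemma derivn2 (R : nzRingType) (p : {poly R}) : p^`(2) = p^`()^`().
Proof. by []. Qed.

Lemma deriv_prod (R : comNzRingType) (I : finType) (F : I -> {poly R}) :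
  (\prod_i F i)^`() =
  \sum_i \prod_k (if k == i then (F k)^`() else F k).
Proof.
(* Induction over duplicate-free sequences, so that [k == i] singles out exactly one factor. *)
have H (r : seq I) : uniq r -> (\prod_(i <- r) F i)^`() =
  \sum_(i <- r) \prod_(k <- r) (if k == i then (F k)^`() else F k).
  elim: r => [|x r IHr] /=; first by rewrite !big_nil derivC.
  case/andP=> xr ur; rewrite !big_cons derivM IHr // eqxx; congr (_ + _).
    congr (_ * _); rewrite !big_seq; apply: eq_bigr => k kr.
    by case: eqP => // ekx; rewrite -ekx kr in xr.
  rewrite big_distrr /= !big_seq; apply: eq_bigr => i ir; rewrite big_cons.
  by case: eqP => // exi; rewrite exi ir in xr.
by rewrite H // index_enum_uniq.
Qed.

Lemma deriv_det (R : comNzRingType) n (A : 'M[{poly R}]_n) :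
  (\det A)^`() =
  \sum_i \det (\matrix_(a, b) if a == i then (A a b)^`() else A a b).
Proof.
rewrite /determinant raddf_sum exchange_big /=; apply: eq_bigr => s _.
rewrite -mulr_sumr.
case: (odd_perm s); rewrite ?expr1 ?expr0 ?mulN1r ?mul1r ?derivN deriv_prod.
  by congr (- _); apply: eq_bigr => i _; apply: eq_bigr => k _; rewrite mxE.
by apply: eq_bigr => i _; apply: eq_bigr => k _; rewrite mxE.
Qed.

(* A Schur complement without denominators: T^-1 is replaced by the adjugate. *)
Lemma det_block_adj (R : comNzRingType) k l (T : 'M[R]_k) (C : 'M_(k, l))
    (L : 'M_(l, k)) (S : 'M_l) :
  \det (block_mx T C L S) * \det T ^+ l =
  \det T * \det (\det T *: S - L *m \adj T *m C).
Proof.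
(* Right multiplication by this block triangular matrix, of determinant [\det T ^+ l], clears the
   upper right block. *)
have := congr1 determinant
  (mulmx_block T C L S 1%:M (- (\adj T *m C)) 0 (\det T)%:M).
rewrite det_mulmx det_ublock det1 mul1r det_scalar => ->.
rewrite !mulmx1 !mulmx0 !addr0 !mulmxN !mul_mx_scalar mulmxA mul_mx_adj.
by rewrite mul_scalar_mx addNr det_lblock addrC mulmxA.
Qed.

Lemma det_bordered (R : idomainType) k (T : 'M[R]_k) (c : 'cV_k)
    (r : 'rV_k) (s : R) : \det T != 0 ->
  \det (block_mx T c r s%:M) = \det T * s - (r *m \adj T *m c) 0 0.
Proof.
move=> T0; apply: (mulfI T0); rewrite mulrC -[X in _ * X]expr1 det_block_adj.
by congr (_ * _); rewrite det_mx11 !mxE eqxx mulr1n.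
Qed.

Lemma det_mx22 (R : comNzRingType) (A : 'M[R]_2) :
  \det A = A 0 0 * A 1 1 - A 0 1 * A 1 0.
Proof.
rewrite (expand_det_row _ 0) !big_ord_recl big_ord0 addr0 /cofactor !det_mx11.
rewrite !mxE /= expr0 expr1 mul1r mulN1r mulrN.
by congr (_ * A _ _ - A _ _ * A _ _); apply: val_inj.
Qed.

(** After multiplication by [\det T], both sides are [\det T] times the 2 by 2 determinant of the
    Schur complement, whose entries are the bordered minors [m i j]. *)
Lemma desnanot_jacobi (R : idomainType) k (T : 'M[R]_k) (C : 'M_(k, 2))
    (L : 'M_(2, k)) (S : 'M_2) : \det T != 0 ->
  let m i j := \det (block_mx T (col j C) (row i L) (S i j)%:M) in
  \det T * \det (block_mx T C L S) = m 0 0 * m 1 1 - m 0 1 * m 1 0.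
Proof.
move=> T0 m; apply: (mulfI T0).
rewrite mulrA mulrC -expr2 det_block_adj; congr (_ * _).
have mE i j : m i j = (\det T *: S - L *m \adj T *m C) i j.
  rewrite /m det_bordered // !mxE; congr (_ - _).
  apply: eq_bigr => a _; rewrite !mxE; congr (_ * _).
  by apply: eq_bigr => b _; rewrite !mxE.
by rewrite !mE det_mx22.
Qed.

Lemma det_cast (R : comNzRingType) m n (F : nat -> nat -> R) : m = n ->
  \det (\matrix_(i < m, j < m) F i j) = \det (\matrix_(i < n, j < n) F i j).
Proof. by move=> ->. Qed.

(** * Wronskians and Jacobi's identity for them *)

Section Wronskian.
Variable R : realFieldType.
Implicit Types (s t : seq {poly R}) (f g : {poly R}).

Lemma wronskianE n s : size s = n ->
  wronskian s = \det (\matrix_(i < n, j < n) (s`_j)^`(i)).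
Proof. by move=> <-. Qed.

Lemma wronskian_nil : wronskian [::] = 1 :> {poly R}.
Proof. exact: det_mx00. Qed.

(* Differentiating any row but the last duplicates the next row. *)
Lemma deriv_wronskian n s : size s = n.+1 ->
  (wronskian s)^`() =
  \det (\matrix_(i < n.+1, j < n.+1) (s`_j)^`(if i == n :> nat then n.+1 else i)).
Proof.
move=> sz; rewrite (wronskianE sz) deriv_det (bigD1 ord_max) //=.
rewrite big1 ?addr0.
  congr (\det _); apply/matrixP => a b; rewrite !mxE -val_eqE.
  by case: eqP => // ->.
move=> i ni; have lt_in : (i < n)%N.
  by rewrite ltn_neqAle -ltnS ltn_ord andbT; apply: contra ni => /eqP e; apply/eqP/val_inj.
have i1 : (i.+1 < n.+1)%N by [].
apply: (@determinant_alternate _ _ _ i (Ordinal i1)).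
  by rewrite -val_eqE /= neq_ltn ltnSn.
move=> b; rewrite !mxE eqxx -val_eqE /= gtn_eqF // derivSn.
Qed.

(** The two border rows hold derivatives of orders k and k+1. A minor with the first one is a
    Wronskian; with the second one it is the derivative of that Wronskian, by [deriv_wronskian]. *)
Lemma wronskian_jacobi s f g : wronskian s != 0 ->
  wronskian s * wronskian (rcons (rcons s f) g) =
  wronskian (rcons s f) * (wronskian (rcons s g))^`()
  - (wronskian (rcons s f))^`() * wronskian (rcons s g).
Proof.
set k := size s => s0.
pose T := \matrix_(i < k, j < k) (s`_j)^`(i).
pose fg (j : 'I_2) := if j == 0 then f else g.
pose C := \matrix_(i < k, j < 2) (fg j)^`(i).
pose L := \matrix_(i < 2, j < k) (s`_j)^`(k + i).
pose S := \matrix_(i < 2, j < 2) (fg j)^`(k + i).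
have := desnanot_jacobi C L S (s0 : \det T != 0); rewrite /=.
have full : \det (block_mx T C L S) = wronskian (rcons (rcons s f) g).
  rewrite (@wronskianE (k + 2)) ?size_rcons ?addn2 //; congr (\det _).
  apply/matrixP=> i j; rewrite [RHS]mxE.
  have nthE : (rcons (rcons s f) g)`_j =
      match split j with inl j' => s`_j' | inr j' => fg j' end.
    rewrite !nth_rcons size_rcons -/k; case: splitP => j' ->.
      by rewrite ltnS ltnW.
    case: j' => [[|[|j']] ltj] //=; rewrite ?addn0 ?addn1 ?ltnn ?ltnSn ?eqxx
      ?(gtn_eqF (ltnSn _)) //.
  rewrite nthE; case: (split_ordP i) => i' ->; case: (split_ordP j) => j' ->.
  - by rewrite block_mxEul mxE.
  - by rewrite block_mxEur mxE.
  - by rewrite block_mxEdl mxE.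
  - by rewrite block_mxEdr mxE.
have bord (i j : 'I_2) :
    \det (block_mx T (col j C) (row i L) (S i j)%:M) =
    \det (\matrix_(a < k.+1, b < k.+1)
            ((rcons s (fg j))`_b)^`(if a == k :> nat then (k + i)%N else a)).
  (* The block matrix has dimension [k + 1], which is not convertible to [k.+1]. *)
  rewrite -(@det_cast _ (k + 1) k.+1 (fun a b =>
    ((rcons s (fg j))`_b)^`(if a == k :> nat then (k + i)%N else a))) ?addn1 //.
  congr (\det _); apply/matrixP=> a b; rewrite [RHS]mxE nth_rcons -/k.
  case: (split_ordP a) => a' ->; case: (split_ordP b) => b' ->.
  - by rewrite block_mxEul mxE /= ltn_eqF.
  - by rewrite block_mxEur !mxE /= ord1 addn0 eqxx ltn_eqF.
  - by rewrite block_mxEdl !mxE /= ord1 addn0 eqxx.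
  - by rewrite block_mxEdr !mxE /= !ord1 addn0 mulr1n !eqxx.
have bord0 (j : 'I_2) :
    \det (block_mx T (col j C) (row 0 L) (S 0 j)%:M) = wronskian (rcons s (fg j)).
  rewrite bord (@wronskianE k.+1) ?size_rcons //; congr (\det _).
  by apply/matrixP=> a b; rewrite !mxE addn0; case: eqP => [->|].
have bord1 (j : 'I_2) :
    \det (block_mx T (col j C) (row 1 L) (S 1 j)%:M) =
    (wronskian (rcons s (fg j)))^`().
  rewrite bord (@deriv_wronskian k) ?size_rcons //; congr (\det _).
  by apply/matrixP=> a b; rewrite !mxE addn1.
by rewrite full !bord0 !bord1 [_ * _ as X in _ - X]mulrC.
Qed.

End Wronskian.

(** * Darboux transformation of second order equations, free of denominators *)

Section Darboux.
Variable R : idomainType.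
Implicit Types (c k l b u v w p q : {poly R}) (m eu ev ew : R).

(* b^2 times c y'' + k y' + (2 c (log b)'' + (k - l) (log b)' + e - m) y at y = w / b. *)
Definition darboux c k l m b w e : {poly R} :=
  c * (w^`(2) * b - 2%:R * w^`() * b^`() + w * b^`(2))
  + k * w^`() * b - l * w * b^`() + (e - m)%:P * w * b.

(** In u times the equation of w minus w times that of u, the terms with [l], [m] and the second
    derivative of b cancel; what remains is b times the claim. *)
Lemma darboux_first_order c k l m b u w p eu ew :
  b != 0 -> b * p = u * w^`() - u^`() * w ->
  darboux c k l m b u eu = 0 -> darboux c k l m b w ew = 0 ->
  c * (b * p^`() - b^`() * p) + k * b * p + (ew - eu)%:P * u * w = 0.
Proof.
move=> b0 bp Lu Lw; apply: (mulfI b0); rewrite mulr0.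
have dbp : b^`() * p + b * p^`() = u * w^`(2) - u^`(2) * w.
  by rewrite -derivM bp derivB !derivM !derivn2; ring.
transitivity (u * darboux c k l m b w ew - w * darboux c k l m b u eu);
  last by rewrite Lu Lw; ring.
transitivity (c * b * (b^`() * p + b * p^`()) - 2%:R * c * b^`() * (b * p)
  + k * b * (b * p) + (ew - eu)%:P * u * w * b); first by ring.
by rewrite dbp bp /darboux !polyCB; ring.
Qed.

(* The second derivative of b enters only through the equation for u. *)
Lemma darboux_step c k l m b u v w p q eu ev ew :
  k - l = c^`() -> b != 0 ->
  b * p = u * w^`() - u^`() * w -> b * q = v * w^`() - v^`() * w ->
  darboux c k l m b u eu = 0 -> darboux c k l m b v ev = 0 ->
  darboux c k l m b w ew = 0 ->
  c * (q^`(2) * u - 2%:R * q^`() * u^`() + q * u^`(2))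
  + (c^`() + k) * q^`() * u - k * q * u^`()
  + ((eu - m - (ew - ev))%:P + k^`()) * q * u
  + 2%:R * (ew - ev)%:P * v * p = 0.
Proof.
move=> ekl b0 bp bq Lu Lv Lw; apply: (mulfI b0); rewrite mulr0.
have F := darboux_first_order b0 bq Lv Lw.
have dF : c^`() * (b * q^`() - b^`() * q) + c * (b * q^`(2) - b^`(2) * q)
  + k^`() * b * q + k * (b^`() * q + b * q^`())
  + (ew - ev)%:P * (v^`() * w + v * w^`()) = 0.
  have := congr1 (@deriv R) F; rewrite deriv0 => <-.
  by rewrite !derivn2 !(derivN, derivD, derivM, derivC); ring.
have uvw : u * (v^`() * w + v * w^`()) =
    2%:R * v * (b * p) + 2%:R * u^`() * v * w - u * (b * q).
  by rewrite bp bq; ring.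
(* This is u F' - 2 u' F, where F = 0 is the first order relation. Adding q times the equation of u
   trades b'' for u'', and the last term eliminates (v w)'. *)
transitivity (u * (c^`() * (b * q^`() - b^`() * q)
  + c * (b * q^`(2) - b^`(2) * q)
  + k^`() * b * q + k * (b^`() * q + b * q^`())
  + (ew - ev)%:P * (v^`() * w + v * w^`()))
  - 2%:R * u^`() * (c * (b * q^`() - b^`() * q) + k * b * q + (ew - ev)%:P * v * w)
  + q * darboux c k l m b u eu
  - (ew - ev)%:P * (u * (v^`() * w + v * w^`()) -
    (2%:R * v * (b * p) + 2%:R * u^`() * v * w - u * (b * q))));
  last by rewrite dF F Lu uvw; ring.
(* The terms in q u b' collect the coefficient k - c' - l, which vanishes. *)
have ek : k = l + c^`() by rewrite -ekl; ring.
by rewrite /darboux ek !(derivD, polyCB); ring.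
Qed.

End Darboux.

(** * Column order, linearity and nonvanishing of Wronskians *)

Section WronskianIndependence.
Variable R : realFieldType.
Implicit Types (s t : seq {poly R}) (f g u w x y : {poly R}).

Lemma wronskian_swap s t x y :
  wronskian (s ++ x :: y :: t) = - wronskian (s ++ y :: x :: t).
Proof.
set n := size (s ++ y :: x :: t).
have sz : n = (size s + (size t).+2)%N by rewrite /n size_cat.
have lt0 : (size s < n)%N by rewrite sz; lia.
have lt1 : ((size s).+1 < n)%N by rewrite sz; lia.
pose i0 := Ordinal lt0; pose i1 := Ordinal lt1.
have ne : i0 != i1 by rewrite -val_eqE /= neq_ltn ltnSn.
rewrite (@wronskianE _ n) ?size_cat // (@wronskianE _ n (s ++ y :: _)) //.
set A := (X in _ = - \det X).
transitivity (\det (xcol i0 i1 A)).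
  congr (\det _); apply/matrixP=> a b; rewrite !mxE; congr (_^`(a)).
  rewrite !nth_cat; case: tpermP => [->|->|/eqP b0 /eqP b1] /=.
  - by rewrite ltnn subnn ltnNge leqnSn /= subSn // subnn.
  - by rewrite ltnn subnn ltnNge leqnSn /= subSn // subnn.
  case: ltnP => // le_sb.
  (* The column lies beyond both x and y, so both lists agree there. *)
  have -> : (b - size s = (b - size s).-2.+2)%N.
    move: b0 b1; rewrite -!val_eqE /=; lia.
  by [].
by rewrite xcolE det_mulmx det_perm odd_tperm ne expr1 mulrN1.
Qed.

Lemma wronskian_shift s1 s2 t x :
  wronskian (s1 ++ x :: s2 ++ t) =
  (-1) ^+ size s2 * wronskian (s1 ++ s2 ++ x :: t).
Proof.
elim: s2 s1 => [|y s2 IHs] s1 /=; first by rewrite expr0 mul1r.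
by rewrite wronskian_swap -cat_rcons IHs cat_rcons exprS mulN1r mulNr.
Qed.

Lemma wronskian_rcons_sub s f g (a : R) :
  wronskian (rcons s (f - a *: g)) =
  wronskian (rcons s f) - a *: wronskian (rcons s g).
Proof.
(* The matrix is transposed because [determinant_multilinear] acts on rows. *)
have E h : wronskian (rcons s h) =
    \det (\matrix_(i < (size s).+1, j < (size s).+1) ((rcons s h)`_i)^`(j)).
  rewrite (wronskianE (size_rcons s h)) -det_tr; congr (\det _).
  by apply/matrixP=> i j; rewrite !mxE.
rewrite !E -[a *: \det _]mul_polyC -mulNr.
rewrite -[X in _ = X + _]mul1r; apply: (determinant_multilinear (i0 := ord_max)).
- apply/rowP=> i; rewrite !mxE !nth_rcons ltnn eqxx mul1r.
  by rewrite derivnB derivnZ mulNr mul_polyC.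
- by apply/matrixP=> i j; rewrite !mxE !nth_rcons lift_max ltn_ord.
- by apply/matrixP=> i j; rewrite !mxE !nth_rcons lift_max ltn_ord.
Qed.

Lemma lead_coef_deriv f : lead_coef f^`() = lead_coef f *+ (size f).-1.
Proof.
rewrite !lead_coefE coef_deriv size_deriv.
case: (size f) (@nth_default _ 0 f) => [|[|n]] //= H;
  by rewrite H // ?mul0rn.
Qed.

(** Comparing leading coefficients gives the same nonzero product multiplied by deg w and by deg u,
    and the characteristic is zero. *)
Lemma eq_size_of_wronskian2_eq0 u w : u != 0 -> w != 0 ->
  u * w^`() = u^`() * w -> size u = size w.
Proof.
move=> u0 w0 /(congr1 lead_coef); rewrite !lead_coefM !lead_coef_deriv.
rewrite mulrnAr mulrnAl => /mulrIn; rewrite mulf_neq0 ?lead_coef_eq0 // => /(_ isT).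
  by move: u0 w0; rewrite -!size_poly_gt0; lia.
Qed.

(** Take for [a] the quotient of the leading coefficients. If w - a u were nonzero, it would satisfy
    the same relation and so have the degree of u, but its coefficient in that degree is zero. *)
Lemma wronskian2_eq0 u w : u != 0 ->
  u * w^`() = u^`() * w -> exists a : R, w = a *: u.
Proof.
move=> u0 E; case: (eqVneq w 0) => [->|w0]; first by exists 0; rewrite scale0r.
pose a := lead_coef w / lead_coef u; exists a; apply/eqP; rewrite -subr_eq0.
apply/negPn/negP => r0.
have szw := eq_size_of_wronskian2_eq0 u0 w0 E.
have szr : size u = size (w - a *: u).
  apply: eq_size_of_wronskian2_eq0 => //.
  by rewrite derivB derivZ mulrBr E -!mul_polyC; ring.
move: r0; rewrite -lead_coef_eq0 lead_coefE -szr coefB coefZ -lead_coefE.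
by rewrite szw -lead_coefE /a divfK ?lead_coef_eq0 // subrr eqxx.
Qed.

(* Induction on the length: if the last two bordered Wronskians are proportional,
   subtracting a multiple of f from g keeps the degrees distinct and shortens the list. *)
Lemma wronskian_neq0 s : uniq ([seq size (p : {poly R}) | p <- s]) -> 0 \notin s ->
  wronskian s != 0.
Proof.
have [n] := ubnP (size s); elim: n s => // n IHn s.
case/lastP: s => [|s g]; first by rewrite wronskian_nil oner_neq0.
case/lastP: s => [_ _|s f].
  by rewrite (@wronskianE _ 1) // det_mx11 mxE inE eq_sym.
rewrite !size_rcons !map_rcons !rcons_uniq !mem_rcons !inE !negb_or ltnS => lts.
case/andP=> /andP[nfg ngs] /andP[nfs us].
rewrite mem_rcons inE negb_or ![0 == _]eq_sym => /and3P[g0 f0 s0].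
have IH (h : {poly R}) : h != 0 -> size h \notin [seq size (p : {poly R}) | p <- s] ->
    wronskian (rcons s h) != 0.
  move=> h0 nh; apply: IHn; first by rewrite size_rcons.
    by rewrite map_rcons rcons_uniq us andbT.
  by rewrite mem_rcons inE negb_or eq_sym h0.
have ws : wronskian s != 0 by apply: IHn => //; apply: ltnW.
have wf : wronskian (rcons s f) != 0 by apply: IH; rewrite // eq_sym.
apply/eqP => wfg.
have := wronskian_jacobi f g ws; rewrite wfg mulr0 => /esym/eqP.
rewrite subr_eq0 => /eqP /(wronskian2_eq0 wf)[a wg].
(* A nonzero [a] ensures that [a *: f] has the size of [f]. *)
have a0 : a != 0.
  by apply: contraNneq (IH g _ _) => // a0; rewrite wg a0 scale0r.
have : wronskian (rcons s (g - a *: f)) == 0.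
  by rewrite wronskian_rcons_sub wg subrr.
apply/negP; apply: IH.
  by rewrite subr_eq0; apply: contraNneq nfg => -> /=; rewrite size_scale.
rewrite -(size_scale f a0) in nfg nfs.
(* The sizes differ, so the larger one is the size of the difference, and it does not occur in
   [s]. *)
case: (ltngtP (size (a *: f)) (size g)) => [lt|lt|eq].
- by rewrite size_polyDl ?size_polyN.
- by rewrite addrC size_polyDl ?size_polyN.
- by rewrite eq eqxx in nfg.
Qed.

End WronskianIndependence.

(** * Differential equations and degrees of the Hermite, Laguerre and Jacobi polynomials *)

Section ClassicalPolynomials.
Variable R : realFieldType.
Implicit Types (a b g h d : R) (Y f : {poly R}).

Lemma pochhammerSr a k : pochhammer a k.+1 = pochhammer a k * (a + k%:R).
Proof. by rewrite /pochhammer big_ord_recr. Qed.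

Lemma pochhammerSl a k : pochhammer a k.+1 = a * pochhammer (a + 1) k.
Proof.
rewrite /pochhammer big_ord_recl addr0; congr (_ * _).
by apply: eq_bigr => i _; rewrite /= -natr1 -addrA [1 + _]addrC.
Qed.

Lemma pochhammer_gt0 a k : 0 < a -> 0 < pochhammer a k.
Proof. by move=> a0; apply: prodr_gt0 => i _; rewrite ltr_wpDr ?ler0n. Qed.

Lemma natr_fact_neq0 k : (k`!)%:R != 0 :> R.
Proof. by rewrite pnatr_eq0 -lt0n fact_gt0. Qed.

(* The operator maps the k-th term of the series to r k - s k, two different powers;
   r k = s k.+1 is then the recursion for the coefficients. *)
Lemma telescope_shift (V : zmodType) n (r s : nat -> V) :
  (forall k, (k < n)%N -> r k = s k.+1) -> r n = 0 -> s 0%N = 0 ->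
  \sum_(k < n.+1) (r k - s k) = 0.
Proof.
move=> rs rn s0; rewrite big_split /= sumrN [X in _ - X]big_ord_recl /= s0 add0r.
rewrite big_ord_recr /= rn addr0; apply/eqP; rewrite subr_eq0; apply/eqP.
by apply: eq_bigr => i _; rewrite rs.
Qed.

Lemma deriv_powS Y d k : Y^`() = d%:P -> (Y ^+ k.+1)^`() = (k.+1%:R * d) *: Y ^+ k.
Proof. by move=> dY; rewrite deriv_exp dY /= -mul_polyC; ring. Qed.

Lemma mul_deriv_pow Y d k : Y^`() = d%:P -> Y * (Y ^+ k)^`() = (k%:R * d) *: Y ^+ k.
Proof.
move=> dY; case: k => [|k]; first by rewrite expr0 derivC mulr0 mul0r scale0r.
by rewrite (deriv_powS _ dY) -scalerAr -exprS.
Qed.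

Definition hypergeometric (c2 c1 : {poly R}) e f :=
  c2 * f^`(2) + c1 * f^`() + e%:P * f.

Lemma hypergeometric_sum c2 c1 e n (c : 'I_n -> R) (P : 'I_n -> {poly R}) :
  hypergeometric c2 c1 e (\sum_(k < n) c k *: P k) =
  \sum_(k < n) c k *: hypergeometric c2 c1 e (P k).
Proof.
rewrite /hypergeometric derivn2 !raddf_sum !mulr_sumr -!big_split /=.
by apply: eq_bigr => k _; rewrite !derivZ -!scalerAr !scalerDr.
Qed.

Lemma hermite_ode n : hypergeometric (4%:R^-1)%:P (- (2%:R^-1 *: 'X))
  (n%:R / 2%:R) (hermite R n) = 0.
Proof.
rewrite /hermite hypergeometric_sum.
set Y := 2%:R *: 'X; have dY : Y^`() = (2%:R)%:P :> {poly R}.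
  by rewrite derivZ derivX alg_polyC.
pose c l : R := (-1) ^+ l * n`!%:R / (l`!%:R * (n - l.*2)`!%:R).
(* For m = n - 2l the operator sends Y^m to m(m-1) Y^(m-2) + l Y^m; [r] carries the first term and
   [s] minus the second. *)
pose r l := (c l * (n - l.*2)%:R * (n - l.*2).-1%:R) *: Y ^+ (n - l.*2).-2.
pose s l := - (c l * l%:R) *: Y ^+ (n - l.*2).
rewrite -[RHS](@telescope_shift _ n./2 r s).
- apply: eq_bigr => l _; rewrite -/(c l) /r /s.
  have ln : (l.*2 <= n)%N by have := ltn_ord l; lia.
  have el : l%:R = (n%:R - (n - l.*2)%:R) / 2%:R :> R.
    by rewrite natrB // -muln2 natrM; field.
  rewrite {}el; move: (n - l.*2)%N => m.
  have d2 : (Y ^+ m)^`(2) = (m%:R * m.-1%:R * 4%:R) *: Y ^+ m.-2.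
    case: m => [|[|m]]; first by rewrite expr0 derivn2 derivC deriv0 !mul0r scale0r.
      by rewrite expr1 derivn2 dY derivC mulr0 mul0r scale0r.
    rewrite derivn2 (deriv_powS _ dY) derivZ (deriv_powS _ dY) scalerA /=.
    by congr (_ *: _); ring.
  have d1 : 'X * (Y ^+ m)^`() = m%:R *: Y ^+ m.
    have := mul_deriv_pow m dY; rewrite /Y -scalerAl [m%:R * _]mulrC -scalerA.
    by apply: scalerI; rewrite pnatr_eq0.
  rewrite /hypergeometric d2 mulNr -scalerAl d1 !mul_polyC scalerA.
  rewrite -addrA -!scaleNr !scalerA -scalerDl scalerDr !scalerA.
  by congr (_ *: _ + _ *: _); field.
- move=> l ln; rewrite /r /s /c.
  have -> : (n - l.+1.*2 = (n - l.*2).-2)%N by lia.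
  have : (1 < n - l.*2)%N by lia.
  case: (n - l.*2)%N => [|[|m]] //= _; congr (_ *: _).
  rewrite !factS !natrM exprS.
  by field; rewrite !nat1r -natrD !pnatr_eq0 -!lt0n !fact_gt0.
(* At the last index m is 0 or 1, so m(m-1) = 0. *)
- rewrite /r; have : ((n - n./2.*2) <= 1)%N by lia.
  by case: (n - _)%N => [|[|?]] //= _; rewrite ?mulr0 ?mul0r scale0r.
- by rewrite /s mulr0 oppr0 scale0r.
Qed.

Lemma laguerre_ode g n : hypergeometric 'X ((g + 2%:R^-1)%:P - 'X) n%:R
  (laguerre (g - 2%:R^-1) n) = 0.
Proof.
rewrite /laguerre hypergeometric_sum.
set Y := - 'X; have dY : Y^`() = (-1)%:P :> {poly R} by rewrite derivN derivX polyCN.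
have -> : g + 2%:R^-1 = g - 2%:R^-1 + 1 by field.
set a := g - 2%:R^-1.
pose c k : R := pochhammer (a + k%:R + 1) (n - k) / ((n - k)`!%:R * k`!%:R).
(* The operator sends Y^k to (n-k) Y^k - k(k+a) Y^(k-1). *)
pose r k := (c k * (n - k)%:R) *: Y ^+ k.
pose s k := (c k * k%:R * (k%:R + a)) *: Y ^+ k.-1.
rewrite -[RHS](@telescope_shift _ n r s).
- apply: eq_bigr => k _; rewrite -/(c k) /r /s natrB; last by rewrite -ltnS.
  have XY : 'X = - Y by rewrite opprK.
  rewrite /hypergeometric.
  have d1 : 'X * (Y ^+ k)^`() = k%:R *: Y ^+ k.
    by rewrite XY mulNr (mul_deriv_pow _ dY) -scaleNr; congr (_ *: _); ring.
  have d0 : (Y ^+ k)^`() = - k%:R *: Y ^+ k.-1.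
    case: {d1}(k : nat) => [|k']; first by rewrite derivC oppr0 scale0r.
    by rewrite (deriv_powS _ dY) mulrN1.
  have d2 : 'X * (Y ^+ k)^`(2) = - (k%:R * k.-1%:R) *: Y ^+ k.-1.
    rewrite derivn2 d0 derivZ -scalerAr XY mulNr (mul_deriv_pow _ dY).
    by rewrite -scaleNr scalerA; congr (_ *: _); ring.
  rewrite d2 mulrBl d1 d0 !mul_polyC scalerA.
  case: {d0 d1 d2}(k : nat) => [|k'] /=.
    rewrite expr0; set Z := (X in c 0%N *: X).
    have -> : Z = (n%:R - 0) *: 1 by rewrite /Z -!mul_polyC; ring.
    by rewrite mulr0 mul0r scale0r !subr0 scalerA.
  rewrite -natr1; set Z := (X in c k'.+1 *: X).
  have -> : Z = (n%:R - (k'%:R + 1)) *: Y ^+ k'.+1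
      - ((k'%:R + 1) * (k'%:R + 1 + a)) *: Y ^+ k'.
    by rewrite /Z exprS -!mul_polyC; ring.
  by rewrite scalerBr !scalerA !mulrA.
- move=> k kn; rewrite /r /s /c /=; congr (_ *: _).
  have -> : (n - k = (n - k.+1).+1)%N by lia.
  rewrite pochhammerSl !factS !natrM.
  have -> : a + k.+1%:R + 1 = a + k%:R + 1 + 1 by rewrite -natr1; ring.
  by field; rewrite !nat1r !pnatr_eq0 -!lt0n !fact_gt0.
- by rewrite /r subnn mulr0 scale0r.
- by rewrite /s mulr0 mul0r scale0r.
Qed.

Lemma jacobi_ode g h n : hypergeometric (1 - 'X ^+ 2)
  ((h - g)%:P - (g + h + 1) *: 'X) (n%:R * (n%:R + g + h))
  (jacobi (g - 2%:R^-1) (h - 2%:R^-1) n) = 0.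
Proof.
rewrite /jacobi hypergeometric_sum.
set Y := 2%:R^-1 *: ('X - 1).
have dY : Y^`() = (2%:R^-1)%:P :> {poly R}.
  by rewrite derivZ derivB derivX derivC subr0 alg_polyC.
set a := g - 2%:R^-1; set b := h - 2%:R^-1.
pose c k : R := pochhammer (n%:R + a + b + 1) k * pochhammer (a + k%:R + 1) (n - k)
  / (k`!%:R * (n - k)`!%:R).
(* Here 1 - X^2 = -4Y(Y+1), and Y^k receives n(n+g+h) - k(k+g+h) = (n-k)(n+k+g+h), while Y^(k-1)
   receives -k(k+a). *)
pose r k := (c k * (n - k)%:R * (n%:R + k%:R + g + h)) *: Y ^+ k.
pose s k := (c k * k%:R * (k%:R + a)) *: Y ^+ k.-1.
rewrite -[RHS](@telescope_shift _ n r s).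
- apply: eq_bigr => k _; rewrite -/(c k) /r /s natrB; last by rewrite -ltnS.
  have XY : 'X = 2%:R *: Y + 1 :> {poly R}.
    by rewrite scalerA mulfV ?pnatr_eq0 // scale1r subrK.
  rewrite /hypergeometric.
  have D1 : ((h - g)%:P - (g + h + 1) *: 'X) * (Y ^+ k)^`() =
      - (k%:R * (a + 1)) *: Y ^+ k.-1 - (k%:R * (g + h + 1)) *: Y ^+ k.
    have -> : (h - g)%:P - (g + h + 1) *: 'X =
        (- (2%:R * g + 1))%:P - (2%:R * (g + h + 1)) *: Y.
      by rewrite XY -!mul_polyC; ring.
    rewrite mulrBl -scalerAl (mul_deriv_pow _ dY) scalerA mul_polyC.
    case: (k : nat) => [|k'].
      by rewrite expr0 derivC !mul0r mulr0 oppr0 scaler0 scale0r.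
    rewrite (deriv_powS _ dY) scalerA /a.
    by congr (_ *: _ - _ *: _); field.
  have D2 : (1 - 'X ^+ 2) * (Y ^+ k)^`(2) =
      - (k%:R * k.-1%:R) *: Y ^+ k.-1 - (k%:R * k.-1%:R) *: Y ^+ k.
    case: (k : nat) => [|k'].
      by rewrite derivn2 derivC deriv0 mulr0 !mul0r oppr0 !scale0r subr0.
    have -> : 1 - 'X ^+ 2 = - 4%:R *: ((Y + 1) * Y).
      by rewrite XY -!mul_polyC; ring.
    rewrite derivn2 (deriv_powS _ dY) derivZ -scalerAr -scalerAl -mulrA.
    rewrite (mul_deriv_pow _ dY) -scalerAr !scalerA mulrDl -exprS mul1r addrC.
    by rewrite scalerDr -scaleNr; congr (_ *: _ + _ *: _); field.
  rewrite D1 D2 mul_polyC {D1 D2}; case: (k : nat) => [|k'] /=.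
    rewrite expr0; set Z := (X in c 0%N *: X).
    have -> : Z = ((n%:R - 0) * (n%:R + 0 + g + h)) *: 1.
      by rewrite /Z -!mul_polyC; ring.
    by rewrite mulr0 mul0r scale0r !subr0 scalerA mulrA.
  rewrite -natr1; set Z := (X in c k'.+1 *: X).
  have -> : Z = ((n%:R - (k'%:R + 1)) * (n%:R + (k'%:R + 1) + g + h)) *: Y ^+ k'.+1
      - ((k'%:R + 1) * (k'%:R + 1 + a)) *: Y ^+ k'.
    by rewrite /Z -!mul_polyC; ring.
  by rewrite scalerBr !scalerA !mulrA.
- move=> k kn; rewrite /r /s /c /=; congr (_ *: _).
  have -> : (n - k = (n - k.+1).+1)%N by lia.
  rewrite pochhammerSl pochhammerSr !factS !natrM.
  have -> : a + k.+1%:R + 1 = a + k%:R + 1 + 1 by rewrite -natr1; ring.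
  by rewrite /a /b; field; rewrite !nat1r !pnatr_eq0 -!lt0n !fact_gt0.
- by rewrite /r subnn mulr0 mul0r scale0r.
- by rewrite /s mulr0 mul0r scale0r.
Qed.

Lemma base_ode (F : baseFamily R) n :
  hypergeometric (c2 F) (C1 F 0) (energy F n / 4%:R) (basePoly F n) = 0.
Proof.
case: F => [|g|g h] /=.
- by rewrite -[RHS](hermite_ode n); congr (hypergeometric _ _ _ _); field.
- by rewrite -[RHS](laguerre_ode g n) addr0; congr (hypergeometric _ _ _ _); field.
- rewrite -[RHS](jacobi_ode g h n) mulr0 addr0.
  by congr (hypergeometric _ _ _ _); field.
Qed.

Lemma size_pow Y k : size Y = 2 -> size (Y ^+ k) = k.+1.
Proof.
move=> sY; have Yk0 : Y ^+ k != 0 by rewrite expf_neq0 // -size_poly_gt0 sY.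
by rewrite (polySpred Yk0) size_exp sY mul1n.
Qed.

Lemma size_sum_pow n (c : nat -> R) Y : size Y = 2 -> c n != 0 ->
  size (\sum_(k < n.+1) c k *: Y ^+ k) = n.+1.
Proof.
move=> sY cn; rewrite big_ord_recr /= addrC size_polyDl size_scale ?size_pow //.
rewrite ltnS; apply: leq_trans (size_sum _ _ _) _; apply/bigmax_leqP=> k _.
by apply: leq_trans (size_scale_leq _ _) _; rewrite size_pow.
Qed.

(** Different indices thus give different degrees, as [wronskian_neq0] demands. *)
Lemma size_basePoly (F : baseFamily R) n : admissible F ->
  size (basePoly F n) = n.+1.
Proof.
case: F => [_|g hg|g h [hg hh]] /=.
- rewrite /hermite; set Y := 2%:R *: 'X.
  have sY : size Y = 2 by rewrite size_scale ?size_polyX ?pnatr_eq0.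
  (* The Hermite sum runs downwards in degree, so its leading term is the one at index 0. *)
  rewrite big_ord_recl /= subn0 expr0 mulr1n !mul1r.
  rewrite divff ?natr_fact_neq0 // scale1r size_polyDl size_pow //.
  rewrite ltnS; apply: leq_trans (size_sum _ _ _) _; apply/bigmax_leqP=> k _.
  apply: leq_trans (size_scale_leq _ _) _; rewrite size_pow //.
  have := ltn_ord k; rewrite /= /bump /=; lia.
- rewrite /laguerre (@size_sum_pow n (fun k =>
    pochhammer (g - 2%:R^-1 + k%:R + 1) (n - k) / ((n - k)`!%:R * k`!%:R))) ?size_polyN ?size_polyX // subnn.
  by rewrite /pochhammer big_ord0 mul1r fact0 mul1r invr_eq0 natr_fact_neq0.
- rewrite /jacobi (@size_sum_pow n (fun k =>
    pochhammer (n%:R + (g - 2%:R^-1) + (h - 2%:R^-1) + 1) k *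
    pochhammer (g - 2%:R^-1 + k%:R + 1) (n - k) / (k`!%:R * (n - k)`!%:R))) //.
    by rewrite size_scale ?invr_eq0 ?pnatr_eq0 // size_XsubC.
  rewrite subnn [pochhammer _ 0]big_ord0 fact0 !mulr1.
  rewrite mulf_neq0 ?invr_eq0 ?natr_fact_neq0 //.
  (* The base of this rising factorial is n + g + h, positive by admissibility. *)
  by apply/lt0r_neq0/pochhammer_gt0; have := ler0n R n; lra.
Qed.

End ClassicalPolynomials.

(** * The operators of the three families, Crum's theorem and the basic equations *)

(** Abstract field elements let [field] treat polynomials and their derivatives as atoms. *)
Lemma clear_denominators (K : fieldType) (c k l m e x x1 x2 q q1 q2 : K) :
  x != 0 ->
  x * (- 4%:R * (c * q2 + (k - 2%:R * c * (x1 / x)) * q1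
    + (c * (x2 / x) - l * (x1 / x) - m) * q) - 4%:R * e * q) =
  - 4%:R * (c * (q2 * x - 2%:R * q1 * x1 + q * x2)
    + k * q1 * x - l * q * x1 + (e - m) * q * x).
Proof. by move=> x0; field. Qed.

Section BasicEquations.
Variables (R : realFieldType) (F : baseFamily R).
Hypothesis hF : admissible F.
Implicit Types (A B : seq nat) (a e n m M : nat).

Lemma C1_C1minus M : C1 F M - C1minus F M = (c2 F)^`().
Proof.
case: F => [|g|g h] /=; first by rewrite subrr derivC.
- by rewrite derivX opprB addrA subrK -polyCB -polyC1; congr _%:P; field.
- by rewrite derivB derivC derivXn expr1 -!mul_polyC !(polyCD, polyCN); ring.
Qed.

(** This recursion and the next two identify the coefficients c' + k, k and m - k' produced by
    [darboux_step] with the family's coefficients at level M + 1. *)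
Lemma C1S M : C1 F M.+1 = (c2 F)^`() + C1 F M.
Proof.
case: F => [|g|g h] /=; first by rewrite derivC add0r.
- by rewrite derivX -natr1 !polyCD; ring.
- by rewrite derivB derivC derivXn expr1 -natr1 -!mul_polyC !(polyCD, polyCM); ring.
Qed.

Lemma C1minusS M : C1minus F M.+1 = C1 F M.
Proof.
case: F => [|g|g h] //=; first by rewrite -natr1; congr (_%:P - _); field.
by rewrite -natr1; congr (_ - _ *: _); ring.
Qed.

Lemma energyS M :
  (energy F M.+1 / 4%:R)%:P = (energy F M / 4%:R)%:P - (C1 F M)^`().
Proof.
case: F => [|g|g h] /=.
- by rewrite derivN derivZ derivX alg_polyC opprK -polyCD -natr1; congr _%:P; field.
- by rewrite derivB derivC derivX -natr1 sub0r opprK -polyCD; congr _%:P; field.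
- rewrite derivB derivC derivZ derivX alg_polyC -natr1 sub0r opprK -polyCD.
  by congr _%:P; field.
Qed.

(** Up to the factor -4, this is Xi times the M-fold operator minus [e], with [b] in place of Xi;
    hence the energies are divided by 4. *)
Definition family_darboux M b w (e : R) :=
  darboux (c2 F) (C1 F M) (C1minus F M) (energy F M / 4%:R) b w (e / 4%:R).

Lemma Xi_neq0 A : uniq A -> Xi F A != 0.
Proof.
move=> uA; apply: wronskian_neq0.
  rewrite -map_comp map_inj_uniq // => a b /=.
  by rewrite !size_basePoly // => -[].
apply/mapP=> -[a _ /(congr1 (fun p : {poly R} => size p))].
by rewrite size_basePoly // size_poly0.
Qed.

Lemma Xi_rcons A n : Xi F (rcons A n) = multiPoly F A n.
Proof. by rewrite /Xi map_rcons. Qed.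

Lemma multiPoly_jacobi B a n : uniq B ->
  Xi F B * multiPoly F (rcons B a) n =
  multiPoly F B a * (multiPoly F B n)^`() - (multiPoly F B a)^`() * multiPoly F B n.
Proof.
move=> uB; rewrite /multiPoly map_rcons; apply: wronskian_jacobi; exact: Xi_neq0.
Qed.

(** This is the basic equation with the exchanged entry in last position. Crum's theorem for [B]
    enters as a hypothesis, since its own induction step is the case [e = a]. *)
Lemma family_darboux_step B a e n : uniq B ->
  (forall k, family_darboux (size B) (Xi F B) (multiPoly F B k) (energy F k) = 0) ->
  family_darboux (size B).+1 (Xi F (rcons B a)) (multiPoly F (rcons B e) n)
    (energy F a + energy F e - energy F n) =
  - ((2%:R * (energy F n - energy F e) / 4%:R) *:
     (multiPoly F (rcons B a) n * Xi F (rcons B e))).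
Proof.
move=> uB crum; rewrite !Xi_rcons.
have := darboux_step (C1_C1minus (size B)) (Xi_neq0 uB) (multiPoly_jacobi a n uB)
  (multiPoly_jacobi e n uB) (crum a) (crum e) (crum n).
set S := (X in X = 0) => S0; apply/eqP; rewrite -subr_eq0; apply/eqP.
rewrite -[RHS]S0 /S /family_darboux /darboux C1S C1minusS.
rewrite [(_ / _ - _)%:P]polyCB energyS -mul_polyC !(polyCB, polyCD, polyCM).
ring.
Qed.

Lemma crum B n : uniq B ->
  family_darboux (size B) (Xi F B) (multiPoly F B n) (energy F n) = 0.
Proof.
elim/last_ind: B n => [|B a IHB] n.
  (* The empty Wronskian is 1 and E(0) = 0, so this is the classical differential equation. *)
  move=> _; rewrite -[RHS](base_ode F n) /family_darboux /darboux /hypergeometric.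
  rewrite /Xi /multiPoly /= wronskian_nil (@wronskianE _ 1) // det_mx11 mxE /=.
  have d1 : (1 : {poly R})^`() = 0 by exact: derivC.
  rewrite d1 deriv0.
  have -> : energy F 0 = 0 by case: F => *; rewrite /= ?mulr0 ?mul0r.
  by rewrite mul0r subr0; ring.
rewrite rcons_uniq => /andP[aB uB]; rewrite size_rcons.
(* With equal entries the source is a multiple of the solution times Xi; absorbing it moves the
   eigenvalue from 2E(a) - E(n) to E(n). *)
have := family_darboux_step a a n uB (fun k => IHB k uB).
move/eqP; rewrite -addr_eq0 => /eqP <-.
rewrite /family_darboux /darboux Xi_rcons -mul_polyC.
rewrite !(polyCB, polyCD, polyCM).
ring.
Qed.

(** The expression is bilinear in [b] and [w], so a common sign is squared. *)
Lemma family_darboux_signr M k (b w : {poly R}) (e : R) :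
  family_darboux M ((-1) ^+ k * b) ((-1) ^+ k * w) e = family_darboux M b w e.
Proof.
rewrite -signr_odd; case: (odd k); rewrite ?mul1r // !mulN1r.
by rewrite /family_darboux /darboux !derivn2 !derivN; ring.
Qed.

Lemma Htilde_darboux A p (e : R) : uniq A ->
  (Xi F A)%:F * (Htilde F A p - (e%:P)%:F * p%:F) =
  (- 4%:R * family_darboux (size A) (Xi F A) p e)%:F.
Proof.
move=> uA; have X0 : (Xi F A)%:F != 0 by rewrite tofrac_eq0 Xi_neq0.
have -> : (e%:P)%:F = 4%:R * ((e / 4%:R)%:P)%:F :> {fraction {poly R}}.
  rewrite mulr_natl -tofracMn -polyCMn; congr (_%:P)%:F.
  by rewrite -mulr_natl; field.
rewrite /Htilde clear_denominators // /family_darboux /darboux polyCB.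
by rewrite !(tofracM, tofracD, tofracN, tofracMn, tofrac1).
Qed.

Lemma Xi_mid (s t : seq nat) a :
  Xi F (s ++ a :: t) = (-1) ^+ size t * Xi F (rcons (s ++ t) a).
Proof.
rewrite /Xi map_cat -[map _ (a :: t)]cats0 /= wronskian_shift.
by rewrite size_map map_rcons map_cat -cats1 -catA.
Qed.

(** The entry moves past [t] only and stays before P_n, so the sign is the one in [Xi_mid]. *)
Lemma multiPoly_mid (s t : seq nat) a n :
  multiPoly F (s ++ a :: t) n = (-1) ^+ size t * multiPoly F (rcons (s ++ t) a) n.
Proof.
rewrite /multiPoly map_cat -cats1 -catA /= wronskian_shift.
by rewrite size_map map_rcons map_cat -!cats1 -!catA.
Qed.

(** The entries [a] and [e] share a position, so exchanging them turns one basic equation into the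
    other. *)
Lemma KreinAdler_identity (s t : seq nat) a e n :
  uniq (s ++ a :: t) ->
  (Xi F (s ++ a :: t))%:F *
    (Htilde F (s ++ a :: t) (multiPoly F (s ++ e :: t) n)
     - ((energy F a + energy F e - energy F n)%:P)%:F
       * (multiPoly F (s ++ e :: t) n)%:F) =
  ((2%:R * (energy F n - energy F e)) *:
     (multiPoly F (s ++ a :: t) n * Xi F (s ++ e :: t)))%:F.
Proof.
move=> u; have uB : uniq (s ++ t).
  by move: u; rewrite !cat_uniq /= negb_or => /and3P[-> /andP[_ ->] /andP[_ ->]].
rewrite Htilde_darboux // !Xi_mid !multiPoly_mid family_darboux_signr.
rewrite size_cat /= addnS -size_cat family_darboux_step //; last first.
  by move=> k; apply: crum.
congr (_%:F); rewrite -!mul_polyC.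
set p := multiPoly _ _ _; set v := Xi _ _.
(* The two signs on the right square to 1, and the factor -4 meets the minus sign and the
   denominator 4 of the source. *)
rewrite mulrACA -expr2 sqrr_sign mul1r mulrN mulNr opprK [LHS]mulrA.
congr (_ * _); rewrite [LHS]mulr_natl -[LHS]polyCMn; congr _%:P.
by rewrite -mulr_natl; field.
Qed.

End BasicEquations.

Theorem mainTheorem9 (R : realFieldType) (F : baseFamily R) (D : seq nat)
    (N j eps : nat) (hF : admissible F)
    (hsort : sorted ltn D) (hpos : all (fun d => (0 < d)%N) D)
    (hKA : KreinAdler D)
    (hN : (1 <= N)%N) (hND : N \notin D)
    (hj : (j < size D)%N)
    (heps : (eps < nth 0%N D j)%N) (hepsD : eps \notin D) (hepsN : eps != N) :
  let dj := nth 0%N D j in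
  let D' := set_nth 0%N D j eps in
  let Et := energy F dj + energy F eps - energy F N in
  (Xi F D)%:F * (Htilde F D (multiPoly F D' N)
                 - (Et%:P)%:F * (multiPoly F D' N)%:F)
    = ((2%:R * (energy F N - energy F eps)) *:
         (multiPoly F D N * Xi F D'))%:F
  /\
  (Xi F D')%:F * (Htilde F D' (multiPoly F D N)
                  - (Et%:P)%:F * (multiPoly F D N)%:F)
    = ((2%:R * (energy F N - energy F dj)) *:
         (multiPoly F D' N * Xi F D))%:F.
Proof.
move=> dj D' Et.
have uD : uniq D by apply: sorted_uniq hsort; [exact: ltn_trans | exact: ltnn].
pose s := take j D; pose t := drop j.+1 D.
have eD : D = s ++ dj :: t by rewrite -drop_nth // cat_take_drop.
have eD' : D' = s ++ eps :: t by rewrite /D' set_nthE hj.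
(* The second identity needs distinct entries in [D'] in order to divide by its Xi. *)
have uD' : uniq D'.
  move: uD hepsD; rewrite eD' eD !cat_uniq mem_cat inE /= !negb_or.
  by move=> /and3P[-> /andP[_ ->] /andP[_ ->]] /and3P[-> _ ->].
rewrite eD' eD in uD uD' *; split; first exact: KreinAdler_identity.
(* The shifted energy is symmetric in d_j and epsilon. *)
by rewrite /Et [energy F dj + _]addrC; exact: KreinAdler_identity.
Qed.
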